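(* Let $n \geq 2$ and $1 \leq k < m$ be integers. Then there exist some integer $N \geq n$ and monomial maps of degree $m$ from $\mathbb{C}^n$ to $\mathbb{C}^N$ that are $k$-fold sphere maps, but not $(k+1)$-fold sphere maps. In particular, these maps do not take all zero-centric spheres to zero-centric spheres.
   Context: $S^{2n-1}$ is the unit sphere in $\mathbb{C}^n$. A zero-centric sphere is a sphere $rS^{2n-1}$, $r>0$, centered at the origin. ''$f$ takes all zero-centric spheres to zero-centric spheres'' means that for every $r>0$ there is $R>0$ with $f(rS^{2n-1})\subset RS^{2N-1}$. Definition: a rational map $f \colon \mathbb{C}^n \dashrightarrow \mathbb{C}^N$ is a $k$-fold sphere map if there exist numbers $0 < r_1 < r_2 < \cdots < r_k < \infty$ and $0 < R_1 , R_2 , \ldots , R_k < \infty$ such that the pole set of $f$ misses $r_kS^{2n-1}$ (and therefore $r_jS^{2n-1}$ for all $j$) and $f(r_jS^{2n-1}) \subset R_jS^{2N-1}$ for all $j = 1,\ldots,k$. A monomial map is a polynomial map each of whose components is a constant times a monomial; its degree is the maximum of the degrees of its components. *)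

(* Defs.v *)
From HB Require Import structures.
From mathcomp Require Import all_boot all_order all_algebra.
From mathcomp Require Import classical_sets reals.
From mathcomp Require Import complex mpoly.
Set Implicit Arguments.
Unset Strict Implicit.
Unset Printing Implicit Defensive.
Import Order.TTheory GRing.Theory Num.Theory.
Import Normc.
Local Open Scope ring_scope.
Local Open Scope classical_set_scope.

Section SphereMaps.
Variable R : realType.
Implicit Types n N k m : nat.

Definition hnorm n (z : 'I_n -> R[i]) : R := Num.sqrt (\sum_i normc (z i) ^+ 2).

Definition zsphere n (r : R) : set ('I_n -> R[i]) := [set z | hnorm z = r].

Arguments zsphere : clear implicits.

Definition rational_map n N := 'I_N -> {fraction {mpoly R[i][n]}}.

(* Any representation of a component as a quotient of polynomials whose
   denominator does not vanish at z may be used, so no choice of lowest terms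
   is needed; w is unique when it exists. *)
Definition rat_value n N (f : rational_map n N)
    (z : 'I_n -> R[i]) (w : 'I_N -> R[i]) : Prop :=
  forall j, exists p q : {mpoly R[i][n]},
    [/\ q.@[z] != 0, f j = tofrac p / tofrac q & w j = p.@[z] / q.@[z]].

Definition pole_set n N (f : rational_map n N) : set ('I_n -> R[i]) :=
  [set z | ~ exists w, rat_value f z w].

Definition rat_image n N (f : rational_map n N) (A : set ('I_n -> R[i])) :
    set ('I_N -> R[i]) :=
  [set w | exists2 z, A z & rat_value f z w].

(* The radii are r 1 < ... < r k; other values of r and R' are irrelevant. *)
Definition kfold_sphere_map n N k (f : rational_map n N) : Prop :=
  exists r R' : nat -> R,
    [/\ (forall j, (1 <= j <= k)%N -> 0 < r j /\ 0 < R' j),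
        (forall j, (1 <= j < k)%N -> r j < r j.+1),
        pole_set f `&` zsphere n (r k) = set0
      & forall j, (1 <= j <= k)%N ->
          rat_image f (zsphere n (r j)) `<=` zsphere N (R' j)].

Definition takes_all_spheres_to_spheres n N (f : rational_map n N) : Prop :=
  forall r : R, 0 < r ->
    exists2 r' : R, 0 < r' & rat_image f (zsphere n r) `<=` zsphere N r'.

Definition poly_map n N := 'I_N -> {mpoly R[i][n]}.

Definition rational_of_poly n N (P : poly_map n N) : rational_map n N :=
  fun j => tofrac (P j).

Definition monomial_map n N (P : poly_map n N) : Prop :=
  forall j, exists (c : R[i]) (a : 'X_{1..n}), P j = c *: 'X_[a].

(* msize is the total degree plus one, and 0 on the zero polynomial. *)
Definition map_degree n N (P : poly_map n N) : nat :=
  (\max_(j < N) (msize (P j)).-1)%N.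

End SphereMaps.

(* Main.v *)
(** Write [x_i = |z_i|^2] and [s = |z|^2 = \sum_i x_i].  If [q] is a real
    polynomial in one variable of degree less than [m] and [C] is large, then
    [C (s + s^2 + ... + s^m) + x_0 q(s)], expanded in the [x_i], has nonnegative
    coefficients, so it is the squared norm of a monomial map [P] of degree [m].
    Since [n >= 2], [x_0] is not constant on any sphere, so [|P|] is constant on
    the sphere of radius [r] exactly when [q(r^2) = 0].  Take
    [q = (X - 1^2) (X - 2^2) ... (X - k^2)]. *)

Require Import Defs.
From mathcomp Require Import all_boot all_order all_algebra.
From mathcomp Require Import classical_sets reals.
From mathcomp Require Import complex mpoly.

(** * Norms, test points and images of spheres under polynomial maps *)

Section PolynomialSphereMaps.
Import Order.TTheory GRing.Theory Num.Theory Normc.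
Local Open Scope ring_scope.
Local Open Scope classical_set_scope.
Variable R : realType.

Lemma sqr_hnorm n (z : 'I_n -> R[i]) :
  hnorm z ^+ 2 = \sum_i normc (z i) ^+ 2.
Proof. by rewrite /hnorm sqr_sqrtr // sumr_ge0 // => i _; rewrite sqr_ge0. Qed.

Lemma hnorm_eq n (z : 'I_n -> R[i]) (r : R) :
  0 <= r -> hnorm z ^+ 2 = r ^+ 2 -> hnorm z = r.
Proof. by move=> r0 /eqP; rewrite eqrXn2 ?sqrtr_ge0 // => /eqP. Qed.

Lemma normc_real (a : R) : normc (a%:C)%C = `|a|.
Proof. by rewrite /normc /= expr0n addr0 sqrtr_sqr. Qed.

Lemma normc_prod (I : Type) (s : seq I) (p : pred I) (F : I -> R[i]) :
  normc (\prod_(i <- s | p i) F i) = \prod_(i <- s | p i) normc (F i).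
Proof. exact: (big_morph _ (@normcM R) (normc1 R)). Qed.

(** Test points: changing the axis [a] alters the modulus of coordinate [ord0] but not the norm. *)
Definition axis_point n (a : 'I_n) (r : R) : 'I_n -> R[i] :=
  fun i => if i == a then (r%:C)%C else 0.

Lemma hnorm_axis_point n (a : 'I_n) (r : R) :
  0 <= r -> hnorm (axis_point n a r) = r.
Proof.
move=> r0; apply: hnorm_eq => //; rewrite sqr_hnorm (bigD1 a) //= /axis_point.
rewrite eqxx normc_real ger0_norm // big1 ?addr0 // => i /negPf->.
by rewrite normc0 expr0n.
Qed.

(** If [P j = p / q] in the fraction field, then [P j * q = p] as polynomials, and [q.@[z] != 0]
    permits cancelling after evaluation. *)
Lemma rat_value_poly n N (P : poly_map R n N) z w :
  rat_value (rational_of_poly P) z w <-> w = fun j => (P j).@[z].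
Proof.
split=> [h|-> j]; last first.
  by exists (P j), 1; rewrite tofrac1 !divr1 meval1 divr1 oner_eq0.
apply/boolp.funext => j; have [p [q [qz + ->]]] := h j.
have q0 : q != 0 by apply: contraNneq qz => ->; rewrite meval0.
move=> /(congr1 ( *%R^~ (tofrac q))); rewrite mulfVK ?tofrac_eq0 //.
rewrite -tofracM => /eqP; rewrite tofrac_eq => /eqP <-.
by rewrite mevalM mulfK.
Qed.

Lemma rat_image_poly n N (P : poly_map R n N) (A : set ('I_n -> R[i]))
    (B : set ('I_N -> R[i])) :
  rat_image (rational_of_poly P) A `<=` B <->
  forall z, A z -> B (fun j => (P j).@[z]).
Proof.
split=> [h z Az|h w [z Az /rat_value_poly ->]]; last exact: h.
by apply: h; exists z => //; apply/rat_value_poly.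
Qed.

Lemma pole_set_poly n N (P : poly_map R n N) :
  pole_set (rational_of_poly P) = set0.
Proof.
rewrite -subset0 => z; apply; exists (fun j => (P j).@[z]).
exact/rat_value_poly.
Qed.

End PolynomialSphereMaps.

(** * The monomial map of degree [m.+1] attached to [q] *)

Section Construction.
Import Order.TTheory GRing.Theory Num.Theory Normc.
Local Open Scope ring_scope.
Local Open Scope classical_set_scope.
Variables (R : realType) (n m : nat) (q : {poly R}).

(* The index [(e, i, f)] stands for the monomial
   [z_i * \prod_(l < e) z_(f l)]; the [f] that are not [ord0] beyond [e] repeat
   a monomial already listed and get coefficient [0]. *)
Local Notation index := ('I_m.+1 * 'I_n.+1 * {ffun 'I_m -> 'I_n.+1})%type.

Definition expo (t : index) : 'X_{1..n.+1} :=
  (U_(t.1.2) + \sum_(l < m | (l < t.1.1)%N) U_(t.2 l))%MM.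

(** The constant [C] above: it exceeds [|q_e|] for every [e <= m], so [C] and [C + q_e] are both
    positive. *)
Definition shift : R := 1 + \sum_(e < m.+1) `|q`_e|.

(** The first factor is the coefficient of [x_i s^e] in [C s^(e+1) + q_e x_0 s^e]. The power [s^e]
    is expanded into ordered words of length [e], so no multinomial coefficients arise. *)
Definition weight (t : index) : R :=
  (shift + (t.1.2 == ord0)%:R * q`_t.1.1) *
  \prod_(l < m | ~~ (l < t.1.1)%N) (t.2 l == ord0)%:R.

Definition component (t : index) : {mpoly R[i][n.+1]} :=
  ((Num.sqrt (weight t))%:C)%C *: 'X_[expo t].

Definition sphere_poly : poly_map R n.+1 #|{: index}| :=
  fun j => component (enum_val j).

Lemma shift_gt0 (e : 'I_m.+1) (b : bool) : 0 < shift + b%:R * q`_e.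
Proof.
have h : `|q`_e| <= \sum_(e < m.+1) `|q`_e|.
  by rewrite (bigD1 e) //= lerDl sumr_ge0.
have h1 : `|q`_e| < shift by apply: le_lt_trans h _; rewrite ltrDr ltr01.
case: b; rewrite ?mul1r ?mul0r ?addr0; last exact: le_lt_trans h1.
by rewrite -ltrBlDr sub0r; apply: le_lt_trans h1; rewrite lerNl lerNnormlW.
Qed.

Lemma weight_ge0 t : 0 <= weight t.
Proof.
apply: mulr_ge0; first exact/ltW/shift_gt0.
by apply: prodr_ge0 => l _; rewrite ler0n.
Qed.

Lemma normc_component t z :
  normc (component t).@[z] ^+ 2 =
  weight t * (normc (z t.1.2) ^+ 2 *
    \prod_(l < m | (l < t.1.1)%N) normc (z (t.2 l)) ^+ 2).
Proof.
rewrite mevalZ normcM exprMn normc_real ger0_norm ?sqrtr_ge0 //.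
rewrite sqr_sqrtr ?weight_ge0 //; congr (_ * _).
rewrite mpolyXD -mprodXE mevalM mevalXU normcM exprMn; congr (_ * _).
rewrite (big_morph _ (mevalM z) (meval1 z)) normc_prod -prodrXl.
by apply: eq_bigr => l _; rewrite mevalXU.
Qed.

(** For each [e], the squared moduli of the components add up to [C s^(e+1) + q_e x_0 s^e]; by the
    bound on [size q], the indices [e <= m] exhaust the coefficients of [q]. *)
Lemma hnorm_sphere_poly (z : 'I_n.+1 -> R[i]) : (size q <= m.+1)%N ->
  hnorm (fun j => (sphere_poly j).@[z]) ^+ 2 =
  shift * \sum_(e < m.+1) (hnorm z ^+ 2) ^+ e.+1
  + normc (z ord0) ^+ 2 * q.[hnorm z ^+ 2].
Proof.
move=> sq; rewrite sqr_hnorm; set s := hnorm z ^+ 2.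
rewrite -(@big_enum_val _ _ _ _ {: index} (fun t => normc (component t).@[z] ^+ 2)).
under eq_bigr do rewrite normc_component.
rewrite (eq_bigl xpredT) //= -(pair_bigA _ (fun a b => weight (a, b) * (normc (z a.2) ^+ 2 *
    \prod_(l < m | (l < a.1)%N) normc (z (b l)) ^+ 2))) /=.
(* By distributivity the sum over words is a product over positions: each position below [e] yields
   [s], each other one yields 1, as only the letter [ord0] counts there. *)
have sumf (e : 'I_m.+1) : \sum_(f : {ffun 'I_m -> 'I_n.+1})
    (\prod_(l < m | ~~ (l < e)%N) (f l == ord0)%:R) *
    (\prod_(l < m | (l < e)%N) normc (z (f l)) ^+ 2) = s ^+ e.
  transitivity (\sum_(f : {ffun 'I_m -> 'I_n.+1}) \prod_(l < m)
      (if (l < e)%N then normc (z (f l)) ^+ 2 else (f l == ord0)%:R)).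
    apply: eq_bigr => f _; rewrite mulrC [RHS](bigID (fun l : 'I_m => (l < e)%N)) /=.
    by congr (_ * _); apply: eq_bigr => l; [move=> -> | move/negPf=> ->].
  rewrite -(bigA_distr_bigA (fun (l : 'I_m) i =>
     if (l < e)%N then normc (z i) ^+ 2 else (i == ord0)%:R)).
  rewrite (eq_bigr (fun l : 'I_m => if (l < e)%N then s else 1)); last first.
    move=> l _; case: ifP => _; first by rewrite /s sqr_hnorm.
    by rewrite (bigD1 ord0) //= big1 ?addr0 // => i /negPf->.
  rewrite -big_mkcond /= -(big_ord_widen _ (fun=> s)) -1?ltnS //.
  by rewrite prodr_const card_ord.
transitivity (\sum_(a : 'I_m.+1 * 'I_n.+1)
    (shift + (a.2 == ord0)%:R * q`_a.1) * normc (z a.2) ^+ 2 * s ^+ a.1).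
  apply: eq_bigr => -[e i] _ /=; rewrite -sumf mulr_sumr; apply: eq_bigr => f _.
  by rewrite /weight /= mulrACA !mulrA.
rewrite -(pair_bigA _ (fun (e : 'I_m.+1) i =>
  (shift + (i == ord0)%:R * q`_e) * normc (z i) ^+ 2 * s ^+ e)) /=.
rewrite (horner_coef_wide _ sq) !mulr_sumr -big_split /=; apply: eq_bigr => e _.
rewrite -mulr_suml (eq_bigr (fun i => shift * normc (z i) ^+ 2 +
  (i == ord0)%:R * q`_e * normc (z i) ^+ 2)); last by move=> i _; rewrite mulrDl.
rewrite big_split /= -mulr_sumr -sqr_hnorm -/s mulrDl exprS mulrA; congr (_ + _).
rewrite (bigD1 ord0) //= big1 ?addr0; last by move=> i /negPf->; rewrite !mul0r.
by rewrite mul1r [q`_e * _]mulrC mulrA.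
Qed.

Lemma monomial_sphere_poly : monomial_map sphere_poly.
Proof. by move=> j; do 2!eexists. Qed.

Lemma degree_sphere_poly : map_degree sphere_poly = m.+1.
Proof.
apply/eqP; rewrite eqn_leq; apply/andP; split.
  apply/bigmax_leqP => j _; rewrite /sphere_poly /component.
  (* A component of weight 0 is the zero polynomial and counts as degree 0. *)
  have [->|c0] := eqVneq (((Num.sqrt (weight (enum_val j)))%:C)%C) 0.
    by rewrite scale0r msize0.
  rewrite msizeZ // msizeX /= mdegD mdeg1 mdeg_sum add1n ltnS.
  under eq_bigr do rewrite mdeg1.
  rewrite sum1_card -[X in (_ <= X)%N](card_ord m); exact: max_card.
(* The degree is attained by [z_0^(m+1)]: for [e = m] no position lies beyond [e], and the weight is
   [C + q_m > 0]. *)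
pose t : index := ((ord_max, ord0), [ffun=> ord0]).
apply: leq_trans (leq_bigmax (enum_rank t)).
rewrite /sphere_poly enum_rankK /component.
have w0 : 0 < weight t.
  apply: mulr_gt0; first exact: shift_gt0.
  by apply: prodr_gt0 => l _; rewrite ffunE eqxx ltr01.
rewrite msizeZ; last by rewrite fmorph_eq0 gt_eqF // sqrtr_gt0.
rewrite msizeX /= mdegD mdeg1 mdeg_sum add1n ltnS /=.
under eq_bigr do rewrite mdeg1.
rewrite (eq_bigl xpredT); last by move=> l; rewrite ltn_ord.
by rewrite sum1_card card_ord.
Qed.

Lemma card_index : (n.+1 <= #|{: index}|)%N.
Proof.
rewrite !card_prod !card_ord card_ffun !card_ord.
by rewrite mulnAC leq_pmull // muln_gt0 expn_gt0.
Qed.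

(** At a root the [x_0] term of [hnorm_sphere_poly] vanishes, and what remains depends on [hnorm z]
    alone. *)
Lemma sphere_poly_root (r : R) : (size q <= m.+1)%N -> 0 < r -> root q (r ^+ 2) ->
  exists2 r' : R, 0 < r' &
    rat_image (rational_of_poly sphere_poly) (@zsphere R n.+1 r)
      `<=` @zsphere R _ r'.
Proof.
move=> sq r0 /rootP qr.
have c0 : 0 < shift * \sum_(e < m.+1) (r ^+ 2) ^+ e.+1.
  apply: mulr_gt0; first by have := shift_gt0 ord0 false; rewrite mul0r addr0.
  rewrite big_ord_recl ltr_wpDr ?exprn_gt0 //.
  by apply: sumr_ge0 => e _; rewrite ltW ?exprn_gt0.
exists (Num.sqrt (shift * \sum_(e < m.+1) (r ^+ 2) ^+ e.+1)).
  by rewrite sqrtr_gt0.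
apply/rat_image_poly => z zr; apply: hnorm_eq; first exact: sqrtr_ge0.
by rewrite hnorm_sphere_poly // zr qr mulr0 addr0 sqr_sqrtr // ltW.
Qed.

End Construction.

(** * Preserved spheres give roots of [q], in dimension at least 2 *)

Section Converse.
Import Order.TTheory GRing.Theory Num.Theory Normc.
Local Open Scope ring_scope.
Local Open Scope classical_set_scope.
Variables (R : realType) (n m : nat) (q : {poly R}).

(** The points of norm [r] on the first and last axes have images of equal norm; subtracting the two
    squared norms leaves [r^2 q(r^2) = 0]. The axes differ because the dimension is [n.+2]. *)
Lemma root_sphere_poly (r r' : R) : (size q <= m.+1)%N -> 0 < r ->
  rat_image (rational_of_poly (sphere_poly R n.+1 m q)) (@zsphere R n.+2 r)
    `<=` @zsphere R _ r' ->
  root q (r ^+ 2).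
Proof.
move=> sq r0 /rat_image_poly h.
have img a : shift R m q * \sum_(e < m.+1) (r ^+ 2) ^+ e.+1
    + normc (axis_point R n.+2 a r ord0) ^+ 2 * q.[r ^+ 2] = r' ^+ 2.
  have e : hnorm (axis_point R n.+2 a r) = r by rewrite hnorm_axis_point // ltW.
  by rewrite -(h _ e) hnorm_sphere_poly // e.
have := img ord0; rewrite -(img ord_max) => /addrI.
rewrite /axis_point eqxx -[_ == _]/false normc0 expr0n mul0r normc_real => /eqP.
rewrite mulf_eq0 expf_eq0 normr_eq0 (gt_eqF r0) /=; exact.
Qed.

(** The squares of the [k] radii are distinct roots of the nonzero polynomial [q]. *)
Lemma kfold_sphere_poly_lt_size k : (size q <= m.+1)%N -> q != 0 ->
  kfold_sphere_map k (rational_of_poly (sphere_poly R n.+1 m q)) ->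
  (k < size q)%N.
Proof.
move=> sq q0 [r [r' [rpos rlt _ rim]]].
have rmono i j : (1 <= i)%N -> (i < j)%N -> (j <= k)%N -> r i < r j.
  move=> i1; elim: j => // j IH; rewrite ltnS leq_eqVlt => /predU1P[<-|ij] jk.
    by apply: rlt; rewrite i1.
  apply: (lt_trans (IH ij (ltnW jk))); apply: rlt.
  by rewrite (leq_trans i1 (ltnW ij)).
pose rs := [seq r j ^+ 2 | j <- iota 1 k].
have sz : size rs = k by rewrite size_map size_iota.
rewrite -sz; apply: max_poly_roots => //.
  apply/allP => _ /mapP[j + ->]; rewrite mem_iota add1n ltnS => jk.
  by apply: root_sphere_poly (rim j jk) => //; case: (rpos j jk).
rewrite map_inj_in_uniq ?iota_uniq // => i j.
rewrite !mem_iota !add1n !ltnS => ik jk /eqP.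
rewrite eqrXn2 ?ltW ?(proj1 (rpos _ _)) // => /eqP rij.
move: ik jk => /andP[i1 ik] /andP[j1 jk].
case: (ssrnat.ltngtP i j) => // ij.
  by have := rmono i j i1 ij jk; rewrite rij ltxx.
by have := rmono j i j1 ij ik; rewrite rij ltxx.
Qed.

End Converse.

(** * The polynomial with roots [1^2, ..., k^2] *)

Section SquareRoots.
Import Order.TTheory GRing.Theory Num.Theory.
Local Open Scope ring_scope.
Variables (R : realType) (n m : nat).

Definition square_roots_poly k : {poly R} :=
  \prod_(a <- [seq j%:R ^+ 2 | j <- iota 1 k]) ('X - a%:P).

Lemma size_square_roots_poly k : size (square_roots_poly k) = k.+1.
Proof. by rewrite size_prod_XsubC size_map size_iota. Qed.

Lemma root_square_roots_poly k j :
  root (square_roots_poly k) (j%:R ^+ 2) = (1 <= j <= k)%N.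
Proof.
rewrite root_prod_XsubC (mem_map (f := fun j => j%:R ^+ 2)).
  by rewrite mem_iota add1n ltnS.
by move=> a b /eqP; rewrite eqrXn2 ?ler0n // eqr_nat => /eqP.
Qed.

Lemma square_roots_poly_neq0 k : square_roots_poly k != 0.
Proof. by rewrite -size_poly_eq0 size_square_roots_poly. Qed.

Lemma kfold_sphere_poly k : (k <= m)%N ->
  kfold_sphere_map k
    (rational_of_poly (sphere_poly R n m (square_roots_poly k))).
Proof.
move=> km.
(* The source radii are [1, ..., k]; choice collects the image radii into one function, with 0 as
   default elsewhere. *)
have /boolp.choice[r' r'P] j : exists r' : R, (1 <= j <= k)%N -> 0 < r' /\
    (rat_image (rational_of_poly (sphere_poly R n m (square_roots_poly k)))
      (@zsphere R n.+1 j%:R) `<=` @zsphere R _ r')%classic.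
  case: (boolP (1 <= j <= k)%N) => jk; last by exists 0.
  have [||| r' r'0 h] := @sphere_poly_root R n m (square_roots_poly k) j%:R.
  - by rewrite size_square_roots_poly.
  - by rewrite ltr0n; case/andP: jk.
  - by rewrite root_square_roots_poly.
  by exists r'.
exists (fun j => j%:R), r'; split.
- by move=> j jk; split; [rewrite ltr0n; case/andP: jk | case: (r'P j jk)].
- by move=> j _; rewrite ltr_nat.
- by rewrite pole_set_poly set0I.
- by move=> j jk; case: (r'P j jk).
Qed.

(** The sphere of radius [k + 1] fails, since [(k + 1)^2] is not a root. *)
Lemma not_all_spheres_sphere_poly k : (k <= m)%N ->
  ~ takes_all_spheres_to_spheres
      (rational_of_poly (sphere_poly R n.+1 m (square_roots_poly k))).
Proof.
move=> km /(_ k.+1%:R (ltr0Sn _ _))[r' _ /root_sphere_poly].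
by rewrite size_square_roots_poly root_square_roots_poly ltnn => /(_ km (ltr0Sn _ _)).
Qed.

End SquareRoots.

Theorem theorem3p7 (R : realType) (n k m : nat) (hn : 2 <= n) (hk : 1 <= k)
    (hkm : k < m) :
  exists (N : nat), n <= N /\
  exists P : poly_map R n N,
    [/\ monomial_map P,
        map_degree P = m,
        kfold_sphere_map k (rational_of_poly P),
        ~ kfold_sphere_map k.+1 (rational_of_poly P)
      & ~ takes_all_spheres_to_spheres (rational_of_poly P)].
Proof.
(* From here the degree is [m.+1], so [k < m.+1] is exactly the bound [size q = k.+1 <= m.+1]. *)
case: n hn => [|[|n]] // _; case: m hkm => [|m] // hkm.
pose q := square_roots_poly R k.
have sq : size q <= m.+1 by rewrite size_square_roots_poly.
exists #|{: 'I_m.+1 * 'I_n.+2 * {ffun 'I_m -> 'I_n.+2}}|.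
split; first exact: card_index.
exists (sphere_poly R n.+1 m q); split.
- exact: monomial_sphere_poly.
- exact: degree_sphere_poly.
- exact: kfold_sphere_poly.
- move=> /(kfold_sphere_poly_lt_size _ _ _ _ _ sq (square_roots_poly_neq0 R k)).
  by rewrite size_square_roots_poly ltnn.
- exact: not_all_spheres_sphere_poly.
Qed.
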